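(* Let $s$ be a fixed positive integer with $s \not\equiv 0 \pmod 3$ such that $s \ge 16$ or $s \in \{8, 11, 14\}$. Then there is a positive constant $c$ (which may depend on $s$) such that for all integers $n \ge 2$, $$r(C_s^3, K_n^3) < 2^{c n \log n}.$$
   Context: A triple system (or $3$-graph) $H$ with vertex set $V(H)$ is a collection of $3$-element subsets of $V(H)$, called edges. $K_n^3$ denotes the complete $3$-graph on $n$ vertices, i.e. the one whose edges are all $3$-element subsets of its vertex set. For $s > 3$, the ($3$-uniform) tight cycle $C_s^3$ is the $3$-graph with vertex set $\mathbb{Z}_s$ (the integers modulo $s$) and edge set $\{\{i, i+1, i+2\} : i \in \mathbb{Z}_s\}$. Given $3$-graphs $F$ and $G$, the Ramsey number $r(F, G)$ is the minimum $N$ such that every red/blue coloring of the edges of $K_N^3$ contains a copy of $F$ all of whose edges are red or a copy of $G$ all of whose edges are blue (copies are not necessarily induced). *)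

(* Defs.v *)
From mathcomp Require Import all_boot all_order all_algebra.

Set Implicit Arguments.
Unset Strict Implicit.
Unset Printing Implicit Defensive.

(* A 3-graph on the finite vertex type V is given by its edge set, a set of
   3-element subsets of V. *)
Definition triple_system (V : finType) (E : {set {set V}}) : Prop :=
  forall e, e \in E -> #|e| = 3.

Definition complete3 (n : nat) : {set {set 'I_n}} := [set e : {set 'I_n} | #|e| == 3].

(* Only meaningful for s > 3: for s < 2 the type 'Z_s is Z/2. *)
Definition tight_cycle (s : nat) : {set {set 'Z_s}} :=
  [set [set i; (i + 1)%R; (i + 2%:R)%R] | i : 'Z_s].

Lemma complete3_triple_system n : triple_system (complete3 n).
Proof. by move=> e; rewrite inE => /eqP. Qed.

Lemma tight_cycle_triple_system s : 3 < s -> triple_system (tight_cycle s).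
Proof.
case: s => [|[|[|[|s]]]] // _ e /imsetP[i _ ->].
have n1 : (1 != 0 :> 'Z_s.+4)%R by [].
have n2 : (2%:R != 0 :> 'Z_s.+4)%R by [].
have e2 : (2%:R = 1 + 1 :> 'Z_s.+4)%R by [].
have d1 : (i + 1 != i)%R by rewrite GRing.addrC -GRing.subr_eq0 GRing.addrK.
have d2 : (i + 2%:R != i)%R by rewrite GRing.addrC -GRing.subr_eq0 GRing.addrK.
have d3 : (i + 2%:R != i + 1)%R.
  by rewrite e2 GRing.addrA (GRing.addrC (i + 1)%R) -GRing.subr_eq0 GRing.addrK.
rewrite setUC cardsU1 !inE negb_or d2 d3 cards2.
by rewrite eq_sym d1.
Qed.

(* The 3-graph F has a (not necessarily induced) copy in the 3-graph H. *)
Definition contains_copy (V W : finType)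
    (F : {set {set V}}) (H : {set {set W}}) : Prop :=
  exists f : V -> W, injective f /\ forall e, e \in F -> f @: e \in H.

(* A red/blue coloring of the edges of the complete 3-graph is given by the set
   of its red edges; the remaining edges are blue. *)
Definition ramsey_property (V W : finType)
    (F : {set {set V}}) (G : {set {set W}}) (N : nat) : Prop :=
  forall red : {set {set 'I_N}}, red \subset complete3 N ->
    contains_copy F red \/ contains_copy G (complete3 N :\: red).

(* N = r(F, G). *)
Definition is_ramsey_number (V W : finType)
    (F : {set {set V}}) (G : {set {set W}}) (N : nat) : Prop :=
  ramsey_property F G N /\ forall M, ramsey_property F G M -> N <= M.

(* Main.v *)
Require Import Defs.
From mathcomp Require Import all_boot all_order all_algebra.
From mathcomp Require Import reals exp.
From mathcomp Require Import boolp zify ring.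

(** Let P be the 3-graph on the vertices 0, ..., 4 whose edges are the triples
    {i, i+1, j} with i + 1 < j.  The theorem follows from three facts about P.

    - Some n^O(n) vertices always contain a red P or a blue clique on n vertices
      ([path3_or_clique]).  As in the argument of Erdos and Rado, vertices are
      taken one by one from a shrinking reservoir, in which each examined pair
      of taken vertices is red (respectively blue) with every remaining vertex.
      Making every pair uniform would cost a factor 2^(n^2), so the taken
      vertices are kept in three levels, each entirely blue.  A new vertex v is
      tested against the levels in turn.  Either all its pairs with the level
      are made blue, and v joins that level, or a single pair (u, v) is made
      red and the next level is tested.  Each test has at most n outcomes, so
      each vertex costs only a factor n^O(1).  A vertex of level i ends an
      increasing path of i red pairs.  After at most 3n steps, either a level
      reaches size n or a vertex passes all three levels.  In the latter case
      a path of three red pairs, with one vertex of the reservoir, is a copy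
      of P.

    - P has closed tight walks of lengths 7 and 8, and a walk can be lengthened
      by 3 by going once more around an edge.  So the tight cycle of length s
      maps homomorphically to P for all s >= 7 not divisible by 3
      ([tight_cycle_path3_hom]).

    - A homomorphic image suffices at a polynomial cost ([arrows_blowup]).  In
      a coloring of I * A, each section g : I -> A induces a coloring of I.  If
      no section contains a blue clique, then one embedding of P works for a
      fraction at least |I|^-5 of all sections.  The counting argument of
      Kovari, Sos, Turan and Erdos, applied to the five coordinates in turn,
      gives each vertex of P as many clones in A as the cycle has vertices.  The
      cycle then lifts to distinct vertices.

    Both sizes |I| and |A| are powers of n^n with constant exponents, which is
    the bound 2^(c n log n). *)

Set Implicit Arguments.
Unset Strict Implicit.
Unset Printing Implicit Defensive.

(** * Red paths and blue cliques *)

Lemma pigeonhole (X Y : finType) (K : {set X}) (C : X -> {set Y}) (S : {set Y}) :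
  0 < #|S| -> S \subset \bigcup_(x in K) C x ->
  exists2 x, x \in K & #|S| <= #|K| * #|C x|.
Proof.
move=> S0 sSC; apply/exists_inP; rewrite -[X in is_true X]negbK negb_exists_in.
apply/negP => /forall_inP small.
have leS : #|S| <= \sum_(x in K) #|C x|.
  apply: leq_trans (subset_leq_card sSC) _.
  elim/big_rec2: _ => [|x m B _ le_Bm]; first by rewrite cards0.
  by rewrite (leq_trans (leq_card_setU _ _)) // leq_add2l.
have K0 : 0 < #|K|.
  rewrite card_gt0; apply/eqP => K0; move: leS.
  by rewrite K0 big_set0 leqNgt S0.
have : #|K| * \sum_(x in K) #|C x| <= #|K| * #|S|.-1.
  rewrite big_distrr /= -sum_nat_const; apply: leq_sum => x xK.
  by rewrite -ltnS prednK // ltnNge small.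
by rewrite leq_pmul2l // => /(leq_trans leS); rewrite leqNgt prednK ?leqnn.
Qed.

Section RedPathsAndBlueLevels.
Variables (V : finType) (E : {set {set V}}).

(** The triples in [E] are red.  The path [p] lists its vertices from the newest to the oldest.  A pair of
    consecutive vertices is red with everything that was still available when
    it was formed: the reservoir [S] and the vertices taken later.  The
    recursive call therefore puts [v] back into the reservoir. *)
Fixpoint red_path (S : {set V}) (p : seq V) : Prop :=
  if p is v :: p' then
    [/\ v \notin S,
        (if p' is u :: _ then forall x, x \in S -> [set u; v; x] \in E else True)
      & red_path (v |: S) p']
  else True.

Lemma red_path_sub (S S' : {set V}) p : S' \subset S -> red_path S p -> red_path S' p.
Proof.
elim: p S S' => //= v p IHp S S' sS'S [vS redp pathp]; split.
- exact: contra (subsetP sS'S v) vS.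
- by case: p redp {IHp pathp} => // u p redp x /(subsetP sS'S); apply: redp.
- by apply: IHp pathp; rewrite setUS.
Qed.

Definition blue_level (S L : {set V}) : Prop :=
  forall a b c, a \in L -> b \in L -> c \in L :|: S ->
    a != b -> c != a -> c != b -> [set a; b; c] \notin E.

Lemma blue_level_sub (S S' L : {set V}) :
  S' \subset S -> blue_level S L -> blue_level S' L.
Proof.
move=> sS'S blL a b c aL bL cLS; apply: blL => //.
by move: cLS; apply: subsetP; rewrite setUS.
Qed.

(** Testing [v] against the level [L].  A vertex of the reservoir either is blue
    with [v] and all of [L] or picks some [u] in [L] with which it is red: these
    are at most [n] cases, and the most frequent one becomes the reservoir. *)
Lemma level_step n (L S : {set V}) v : #|L| < n -> 0 < #|S| ->
  exists S' : {set V}, [/\ S' \subset S, #|S| <= n * #|S'| &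
    (forall u x, u \in L -> x \in S' -> [set u; v; x] \notin E) \/
    (exists2 u, u \in L & forall x, x \in S' -> [set u; v; x] \in E)].
Proof.
move=> ltLn S0.
pose C o := if o is Some u then [set x in S | [set u; v; x] \in E]
            else [set x in S | [forall u in L, [set u; v; x] \notin E]].
have [|o oK leS] := @pigeonhole _ _ (None |: Some @: L) C S S0.
  apply/subsetP => x xS; apply/bigcupP.
  have [blx|] := boolP [forall u in L, [set u; v; x] \notin E].
    by exists None; rewrite ?setU11 // inE xS.
  rewrite negb_forall_in => /exists_inP[u uL]; rewrite negbK => redx.
  by exists (Some u); rewrite inE ?xS // imset_f // orbT.
have leKn : #|None |: Some @: L| <= n.
  apply: leq_trans (leq_card_setU _ _) _; rewrite cards1 add1n.
  exact: leq_ltn_trans (leq_imset_card _ _) ltLn.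
exists (C o); split; last 1 first.
- case: o oK {leS} => [u|] oK; [right | left].
    move: oK; rewrite !inE /= => /imsetP[u' u'L [->]]; exists u' => // x.
    by rewrite inE => /andP[].
  by move=> u x uL; rewrite inE => /andP[_ /forall_inP]; apply.
- by case: o {oK leS} => [u|]; apply/subsetP => x; rewrite inE => /andP[].
- by apply: leq_trans leS _; rewrite leq_mul2r leKn orbT.
Qed.

(** A red pair between a new vertex and level [i] always prolongs a red path of
    [i] pairs. *)
Definition leveled k (S : {set V}) (lev : nat -> {set V}) : Prop :=
  forall i, i < k -> blue_level S (lev i) /\
    forall v, v \in lev i -> exists2 p, size p = i & red_path S (v :: p).

(** [v] climbs the levels as long as it finds a red partner.  The path ending at
    [v] is built anew at every level, by appending [v] to the path of the
    partner found there, so one red pair per level is enough. *)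
Lemma place_vertex k n (lev : nat -> {set V}) (S : {set V}) v :
  leveled k (v |: S) lev -> (forall i, i < k -> #|lev i| < n) ->
  v \notin S -> 0 < #|S| ->
  exists S' : {set V}, [/\ S' \subset S, #|S| <= n ^ k * #|S'| &
    (exists2 p, size p = k & red_path S' (v :: p)) \/
    (exists i, [/\ i < k, exists2 p, size p = i & red_path S' (v :: p) &
       forall u x, u \in lev i -> x \in S' -> [set u; v; x] \notin E])].
Proof.
move=> levP small vS S0; elim: k => [|k IHk] in levP small *.
  by exists S; split=> //; [rewrite mul1n | left; exists [::]].
have [||S' [sS'S leS [[p szp pathp]|[i [ltik pathi bli]]]]] := IHk.
- by move=> i ltik; apply: levP; apply: ltnW.
- by move=> i ltik; apply: small; apply: ltnW.
- have S'0 : 0 < #|S'| by case: #|S'| leS => //; rewrite muln0 leqNgt S0.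
  have [S'' [sS'' leS' H]] := level_step v (small k (ltnSn k)) S'0.
  have sS''S := subset_trans sS'' sS'S.
  exists S''; split=> //.
    by rewrite expnSr -mulnA (leq_trans leS) // leq_mul2l leS' orbT.
  case: H => [bl|[u uL redu]]; [right | left].
    by exists k; split=> //; exists p => //; apply: red_path_sub pathp.
  have [_ /(_ u uL)[q szq pathq]] := levP k (ltnSn k).
  exists (u :: q); first by rewrite /= szq.
  split=> //; first by apply: contra vS; apply: subsetP.
  by apply: red_path_sub pathq; rewrite setUS.
- exists S'; split=> //; last by right; exists i; split=> //; apply: ltnW.
  apply: leq_trans leS _; rewrite leq_mul2r leq_pexp2l ?orbT //.
  by case: (n) (small k (ltnSn k)).
Qed.

Lemma leveled_insert k (S S' : {set V}) lev v i :
  leveled k S lev -> v \in S -> v \notin S' -> S' \subset S -> i < k ->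
  (exists2 p, size p = i & red_path S' (v :: p)) ->
  (forall u x, u \in lev i -> x \in S' -> [set u; v; x] \notin E) ->
  leveled k S' (fun j => if j == i then v |: lev i else lev j).
Proof.
move=> levP vS vS' sS'S ltik pathv blv j ltjk.
have [blj pathj] := levP j ltjk.
case: eqP => [eji|_]; last first.
  split; first exact: blue_level_sub blj.
  by move=> u /pathj[p szp pathp]; exists p => //; apply: red_path_sub pathp.
subst j; split; last first.
  move=> u; rewrite !inE => /orP[/eqP-> //|/pathj[p szp pathp]].
  by exists p => //; apply: red_path_sub pathp.
have bl3 a b : a \in lev i -> b \in lev i -> a != b -> v != a -> v != b ->
    [set a; b; v] \notin E.
  by move=> aL bL; apply: blj => //; rewrite inE vS orbT.
have swap a b c : [set a; b; c] = [set a; c; b] :> {set V} by rewrite setUAC.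
have rot a b c : [set a; b; c] = [set b; a; c] :> {set V} by rewrite (setUC [set a]).
move=> a b c; rewrite !inE => aL bL cL ab ca cb.
have [eav|nav] := eqVneq a v.
  subst a; rewrite eq_sym in ab; move: bL; rewrite (negPf ab) /= => bL.
  rewrite (negPf ca) /= in cL; case/orP: cL => [cL|cS']; last by rewrite rot blv.
  by rewrite rot swap bl3 // eq_sym.
rewrite (negPf nav) /= in aL.
have [ebv|nbv] := eqVneq b v.
  subst b; rewrite (negPf cb) /= in cL.
  case/orP: cL => [cL|cS']; last by rewrite blv.
  by rewrite swap bl3 // eq_sym.
rewrite (negPf nbv) /= in bL.
have [->|ncv] := eqVneq c v; first by rewrite bl3 // eq_sym.
rewrite (negPf ncv) /= in cL.
apply: blj => //; rewrite inE; case/orP: cL => [->//|cS'].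
by rewrite (subsetP sS'S _ cS') orbT.
Qed.

(** The [k] levels together hold at most [k * n.-1] vertices before one of them
    is a blue clique, which bounds the number of steps.  Each step costs a
    factor [n ^ k] for the tests, and the last factor [n] in [n ^ k.+1] pays
    for the removal of the new vertex from the reservoir. *)
Lemma red_path_or_blue_set k n m (lev : nat -> {set V}) (S : {set V}) :
  1 < n -> leveled k S lev ->
  k * n.-1 < \sum_(i < k) #|lev i| + m -> (n ^ k.+1) ^ m <= #|S| ->
  (exists S' p, [/\ S' != set0, size p = k.+1 & red_path S' p]) \/
  (exists2 A : {set V}, n <= #|A| & blue_level set0 A).
Proof.
move=> n1; have n0 := ltnW n1; elim: m lev S => [|m IHm] lev S levP total geS;
  (have [/existsP[i bigi]|/existsPn small] := boolP [exists i : 'I_k, n <= #|lev i|];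
   first by right; exists (lev i) => //; apply: blue_level_sub (sub0set S) _;
            case: (levP i (ltn_ord i))).
  suff : \sum_(i < k) #|lev i| <= k * n.-1 by rewrite leqNgt -[\sum__ _]addn0 total.
  rewrite -[k in k * _]card_ord -sum_nat_const; apply: leq_sum => i _.
  by rewrite -ltnS prednK // ltnNge small.
have {}small i : i < k -> #|lev i| < n.
  by move=> ltik; rewrite ltnNge; apply: (small (Ordinal ltik)).
have b0 : 0 < (n ^ k.+1) ^ m by rewrite !expn_gt0 n0.
have [v vS] : exists v, v \in S.
  apply/set0Pn; rewrite -card_gt0; apply: leq_trans geS.
  by rewrite !expn_gt0 n0.
have geS1 : n ^ k * (n ^ k.+1) ^ m <= #|S :\ v|.
  have b'0 : 0 < n ^ k * (n ^ k.+1) ^ m by rewrite muln_gt0 b0 expn_gt0 n0.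
  move: geS; rewrite (cardsD1 v) vS (expnS (n ^ k.+1)) {1}(expnS n) -mulnA.
  move: b'0; move: (n ^ k * _) => b b'0 geb; rewrite -ltnS -[X in _ < X]add1n.
  by apply: leq_trans geb; rewrite -[X in X < _]mul1n ltn_pmul2r.
have S10 : 0 < #|S :\ v|.
  by apply: leq_trans geS1; rewrite muln_gt0 b0 expn_gt0 n0.
have vS1 : v \notin S :\ v by rewrite setD11.
have [|S' [sS' leS1 [[p szp pathp]|[i [ltik pathv blv]]]]] :=
    @place_vertex k n lev (S :\ v) v _ small vS1 S10.
- by rewrite setD1K.
- left; exists S', (v :: p); split=> //=; last by rewrite szp.
  by rewrite -card_gt0; case: #|S'| leS1 => //; rewrite muln0 leqNgt S10.
have vS' : v \notin S' by apply: contra vS1; apply: subsetP.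
have sS'S : S' \subset S by apply: subset_trans sS' _; apply: subD1set.
have vL : v \notin lev i.
  by apply/negP => /(proj2 (levP i ltik))[p _ [/negP[]]].
apply: (IHm _ S' (leveled_insert levP vS vS' sS'S ltik pathv blv)).
- move: total; rewrite (bigD1 (Ordinal ltik)) //= => total.
  rewrite (bigD1 (Ordinal ltik)) //= eqxx cardsU1 vL.
  rewrite (eq_bigr (fun j : 'I_k => #|lev j|)).
    by rewrite add1n !addSn -addnS.
  by move=> j; rewrite -val_eqE /= => /negPf->.
- by rewrite -(@leq_pmul2l (n ^ k)) ?expn_gt0 ?n0 // (leq_trans geS1).
Qed.

End RedPathsAndBlueLevels.

(** What an increasing path of red pairs gives, together with one vertex of the
    reservoir: a pair of successive vertices is red with every later vertex. *)
Definition path3 k : {set {set 'I_k}} :=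
  [set e | [exists a : 'I_k, exists b : 'I_k, exists c : 'I_k,
     [&& b == a.+1 :> nat, b < c & e == [set a; b; c]]]].

Definition arrows (V U : finType) (F : {set {set U}}) n : Prop :=
  forall E : {set {set V}},
    contains_copy F E \/ contains_copy (complete3 n) (~: E).

Section RedPathCopy.
Variables (V : finType) (E : {set {set V}}).

(** The vertex [x] of the reservoir is later than all of [p], so [x :: p] is
    again listed from newest to oldest: edges are the triples at positions
    [j.+1], [j] and [i] with [i < j]. *)
Lemma red_path_nth (S : {set V}) x p : red_path E S p -> x \in S ->
  uniq (x :: p) /\ forall i j, i < j -> j < size p ->
    [set nth x (x :: p) j.+1; nth x (x :: p) j; nth x (x :: p) i] \in E.
Proof.
elim: p S x => [|v p IHp] S x /=; first by [].
case=> vS redv pathp xS.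
have xS' : x \in v |: S by rewrite inE xS orbT.
have [ux Ex] := IHp _ x pathp xS'.
have [uv Ev] := IHp _ v pathp (setU11 v S).
have xv : x != v by apply: contraNneq vS => <-.
split; first by move: ux uv => /= /andP[xp ->] /andP[-> _]; rewrite inE negb_or xv xp.
case=> [|i] [|j] // ltij; rewrite ltnS => ltjp /=; last first.
  by have := Ev i j ltij ltjp; rewrite /= !(set_nth_default x v) //=; lia.
case: j ltij ltjp => [|j] _ ltjp; last exact: Ex 0 j.+1 isT ltjp.
by case: p redv ltjp {IHp pathp ux Ex uv Ev} => //= u p redv _; apply: redv.
Qed.

Lemma red_path_copy k (S : {set V}) p : S != set0 -> size p = k ->
  red_path E S p -> contains_copy (path3 k.+1) E.
Proof.
case/set0Pn => x xS szp /red_path_nth/(_ xS)[uq redp].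
exists (fun a : 'I_k.+1 => nth x (x :: p) (k - a)); split.
  move=> a b /eqP; rewrite nth_uniq //= ?szp ?ltnS ?leq_subr // => /eqP eqab.
  by apply: val_inj; rewrite /= -(subKn (leq_ord a)) eqab subKn // leq_ord.
move=> e; rewrite inE => /existsP[a /existsP[b /existsP[c /and3P[/eqP eb ltbc /eqP->]]]].
rewrite !imsetU !imset_set1.
have ltck := leq_ord c.
have -> : k - a = (k - b).+1 by rewrite eb subnSK // -eb ltnW // (leq_trans ltbc).
apply: redp; first by apply: ltn_sub2l => //; apply: leq_trans ltck.
by rewrite szp eb ltn_subrL /= (leq_ltn_trans _ (leq_trans ltbc ltck)).
Qed.

Lemma blue_level_copy n (A : {set V}) :
  n <= #|A| -> blue_level E set0 A -> contains_copy (complete3 n) (~: E).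
Proof.
move=> leA blA; pose f (i : 'I_n) := enum_val (widen_ord leA i).
have injf : injective f.
  by move=> i j /enum_val_inj/(congr1 val) /= eqij; apply: val_inj.
exists f; split=> // e; rewrite !inE => card_e.
have fA i : f i \in A by apply: enum_valP.
case: (cards_eqP e) card_e => -[|a [|b [|c []]]] //= uq _.
have -> : [set x | x \in [:: a; b; c]] = [set a; b; c].
  by apply/setP => x; rewrite !inE orbA.
move: uq; rewrite !inE negb_or => /and3P[/andP[ab ac] bc _].
rewrite !imsetU !imset_set1.
by apply: blA; rewrite ?setU0 ?fA ?(inj_eq injf) // eq_sym.
Qed.
End RedPathCopy.

Lemma path3_or_clique (V : finType) k n : 0 < k -> 1 < n ->
  (n ^ k.+1) ^ (k * n) <= #|V| -> @arrows V _ (path3 k.+2) n.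
Proof.
move=> k0 n1 geV E.
have lev0 : leveled E k setT (fun=> set0).
  by move=> i _; split=> [a b c|v]; rewrite inE.
have := @red_path_or_blue_set V E k n (k * n) _ _ n1 lev0.
case.
- by rewrite big1 => [|i _]; rewrite ?cards0 // add0n ltn_pmul2l // prednK // ltnW.
- by rewrite cardsT.
- by case=> S [p [S0 szp pathp]]; left; apply: red_path_copy pathp.
- by case=> A geA blA; right; apply: blue_level_copy blA.
Qed.

(** * Clones by counting *)

(** Removing the lightest element of a set does not decrease the average
    weight. *)
Lemma exists_heavy_subset (A : finType) (w : A -> nat) l : l <= #|A| ->
  exists2 B : {set A}, #|B| = l &
    l * \sum_a w a <= #|A| * \sum_(a in B) w a.
Proof.
have -> : \sum_a w a = \sum_(a in [set: A]) w a by apply: eq_bigl => a; rewrite inE.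
rewrite -cardsT => /subnKC/esym; move: (_ - l) => m.
elim: m [set: A] => [|m IHm] B eqB.
  by exists B; rewrite ?addn0 // eqB addn0.
have /card_gt0P[a0 a0B] : 0 < #|B| by rewrite eqB addnS.
have [a aB minw] : exists2 a, a \in B & forall b, b \in B -> w a <= w b.
  by case: (arg_minnP w a0B) => a aB minw; exists a.
have eqB1 : #|B :\ a| = l + m by apply/eqP; rewrite -eqSS -addnS -eqB (cardsD1 a B) aB.
have [C eqC leC] := IHm _ eqB1; exists C => //.
have lea : #|B| * w a <= \sum_(b in B) w b.
  by rewrite -sum_nat_const; apply: leq_sum.
rewrite addnS in eqB *.
rewrite eqB (big_setD1 a) //= in lea *.
case: (posnP (l + m)) => [lm0|lm0]; first by move: lm0; case: (l).
rewrite -(leq_pmul2l lm0).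
move: leC lea; set s := \sum_(b in _) w b; set s' := \sum_(b in _) w b.
by nia.
Qed.

(** If a property has density [1 / d], then [t] clones of one coordinate can be
    found at the cost of lowering the density to [1 / clone_loss t d]. *)
Definition clone_loss t d := 2 * d * (2 * d * t) ^ t.

Lemma leq_iter_clone_loss t d k : 0 < t -> 0 < d -> d <= iter k (clone_loss t) d.
Proof.
move=> t0 d0; elim: k => //= k IHk; have e0 := leq_trans d0 IHk.
apply: leq_trans IHk _; set e := iter _ _ _ in e0 *.
by rewrite /clone_loss -mulnA mulnCA leq_pmulr // !(muln_gt0, expn_gt0) e0 t0.
Qed.

Section CommonNeighbours.
Variables (A Y T : finType) (R : A -> Y -> bool).

(** [A] is first shrunk to a set [B] of [2 * d * #|T|] elements without losing
    density.  Then a fraction at least [1 / (2 * d)] of [Y] has [#|T|]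
    neighbours in [B], and the maps from [T] to [B] are few enough for a
    pigeonhole argument.  Without the shrinking, their number, hence the loss,
    would grow with [A], and the argument could not be iterated over several
    coordinates that all range over [A]. *)
Lemma common_neighbours d : 0 < d -> 0 < #|T| -> 0 < #|Y| ->
  2 * d * #|T| <= #|A| ->
  #|A| * #|Y| <= d * \sum_a #|[set y | R a y]| ->
  exists2 f : T -> A, injective f &
    #|Y| <= clone_loss #|T| d * #|[set y | [forall x, R (f x) y]]|.
Proof.
move=> d0 t0 Y0 leA dense.
set l := 2 * d * #|T| in leA *; have l0 : 0 < l by rewrite !muln_gt0 d0 t0.
have [B cardB heavy] := exists_heavy_subset (fun a => #|[set y | R a y]|) leA.
have A0 : 0 < #|A| by apply: leq_trans leA.
have denseB : l * #|Y| <= d * \sum_(a in B) #|[set y | R a y]|.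
  rewrite -(leq_pmul2l A0) mulnCA (leq_trans (leq_mul (leqnn l) dense)) //.
  by rewrite mulnCA [X in _ <= X]mulnCA leq_mul2l heavy orbT.
pose deg y := #|[set a in B | R a y]|.
have degE : \sum_(a in B) #|[set y | R a y]| = \sum_y deg y.
  rewrite (eq_bigr (fun a => \sum_y R a y)) => [|a _]; last first.
    by rewrite -sum1dep_card big_mkcond /=; apply: eq_bigr => y _; case: (R a y).
  rewrite exchange_big; apply: eq_bigr => y _ /=.
  rewrite /deg -sum1dep_card big_mkcondr /=.
  by apply: eq_bigr => a _; case: (R a y).
pose Y1 := [set y | #|T| <= deg y].
have leY1 : #|Y| <= 2 * d * #|Y1|.
  have le_deg : \sum_y deg y <= l * #|Y1| + #|T| * #|Y|.
    rewrite (bigID (mem Y1)) /= leq_add //.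
      rewrite mulnC -sum_nat_const; apply: leq_sum => y _.
      by rewrite -cardB subset_leq_card //; apply/subsetP => a; rewrite inE => /andP[].
    rewrite mulnC -sum_nat_const big_mkcond /=; apply: leq_sum => y _.
    by rewrite inE; case: (leqP #|T| (deg y)) => //= lt; apply: ltnW.
  move: denseB; rewrite degE /l in le_deg * => denseB.
  have : d * #|T| * #|Y| <= d * #|T| * (2 * d * #|Y1|).
    have := leq_trans denseB (leq_mul (leqnn d) le_deg).
    rewrite mulnDr; set y := #|Y|; set y1 := #|Y1|; set t := #|T|; nia.
  by rewrite leq_pmul2l // muln_gt0 d0.
have Y10 : 0 < #|Y1|.
  by move: leY1; case: #|Y1| => //; rewrite muln0 leqNgt Y0.
pose K := [set f : {ffun T -> A} | f \in ffun_on (mem B)].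
pose C (f : {ffun T -> A}) := [set y | injectiveb f && [forall x, R (f x) y]].
have [|f _ lef] := @pigeonhole _ _ K C Y1 Y10.
  apply/subsetP => y; rewrite inE => ledeg; apply/bigcupP.
  have N i : i \in [set a in B | R a y] -> i \in B /\ R i y by rewrite inE => /andP[].
  exists [ffun x : T => enum_val (widen_ord ledeg (enum_rank x))].
    rewrite inE; apply/ffun_onP => x; rewrite ffunE.
    by have [] := N _ (enum_valP (widen_ord ledeg (enum_rank x))).
  rewrite inE; apply/andP; split.
    apply/injectiveP => x x'; rewrite !ffunE => /enum_val_inj/(congr1 val) /= eqx.
    by apply: enum_rank_inj; apply: val_inj.
  apply/forallP => x; rewrite ffunE.
  by have [] := N _ (enum_valP (widen_ord ledeg (enum_rank x))).
have cardK : #|K| = l ^ #|T| by rewrite cardsE card_ffun_on cardB.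
have [injf|ninj] := boolP (injectiveb f); last first.
  move: lef; suff -> : C f = set0 by rewrite cards0 muln0 leqNgt Y10.
  by apply/setP => y; rewrite !inE (negPf ninj).
exists f; first exact/injectiveP.
apply: leq_trans leY1 _; rewrite /clone_loss -/l -[X in _ <= X]mulnA leq_mul2l.
apply/orP; right; move: lef; rewrite cardK.
by congr (_ <= _ * #|pred_of_set _|); apply/setP => y; rewrite !inE injf.
Qed.
End CommonNeighbours.

Section CloneCoordinates.
Variables (I A T : finType).
Implicit Types (g : {ffun I -> A}) (P : {set {ffun I -> A}}).

Definition subst_at i a g : {ffun I -> A} := [ffun j => if j == i then a else g j].

(** Overwriting coordinate [i] preserves density: exchanging the new value with
    the old one is an involution of the pairs (value, function). *)
Lemma sum_card_subst_at i P :
  \sum_a #|[set g | subst_at i a g \in P]| = #|A| * #|P|.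
Proof.
pose swap (q : A * {ffun I -> A}) := (q.2 i, subst_at i q.1 q.2).
have swapK : involutive swap.
  case=> a g; rewrite /swap /= !ffunE eqxx; congr (_, _).
  by apply/ffunP => j; rewrite !ffunE; case: eqP => // ->.
rewrite (eq_bigr (fun a => \sum_g (subst_at i a g \in P))) => [|a _]; last first.
  by rewrite -sum1dep_card big_mkcond /=; apply: eq_bigr => g _; case: (_ \in P).
rewrite pair_bigA (reindex_inj (inv_inj swapK)) /=.
rewrite (eq_bigr (fun q : A * {ffun I -> A} => (q.2 \in P : nat))); last first.
  by move=> q _; have /(congr1 snd) /= -> := swapK q.
rewrite -(pair_bigA _ (fun _ g => (g \in P : nat))) /= sum_nat_const; congr (_ * _).
by rewrite -sum1_card [RHS]big_mkcond /=; apply: eq_bigr => g _; case: (_ \in P).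
Qed.

(** One coordinate of [s] at a time, [common_neighbours] is applied to the
    relation between a value and a function given by overwriting this
    coordinate.  All coordinates of the functions are kept throughout; those
    outside [s] end up frozen at the values of [g]. *)
Lemma clone_coordinates (s : seq I) d P : 0 < d -> 0 < #|T| ->
  2 * iter (size s) (clone_loss #|T|) d * #|T| <= #|A| ->
  #|{ffun I -> A}| <= d * #|P| ->
  exists (g : {ffun I -> A}) (G : I -> T -> A),
    (forall i, i \in s -> injective (G i)) /\
    forall c : I -> T, [ffun i => if i \in s then G i (c i) else g i] \in P.
Proof.
move=> d0 t0.
elim: s d P d0 => [|i s IHs] d P d0 leA dense.
  have A0 : 0 < #|A| by apply: leq_trans leA; rewrite !muln_gt0 d0.
  have : 0 < #|P|.
    case: #|P| dense => //; rewrite muln0 card_ffun leqNgt expn_gt0 A0 //.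
  case/card_gt0P => g gP; exists g, (fun i _ => g i); split=> // c.
  by congr (_ \in P): gP; apply/ffunP => i; rewrite ffunE.
have geiter : d <= iter (size s).+1 (clone_loss #|T|) d.
  exact: leq_iter_clone_loss.
have A0 : 0 < #|A|.
  by apply: leq_trans leA; rewrite muln_gt0 t0 andbT muln_gt0; apply: leq_trans geiter.
have [|||f injf lef] := @common_neighbours A _ T (fun a g => subst_at i a g \in P) d d0 t0.
- by rewrite card_ffun expn_gt0 A0.
- by apply: leq_trans leA; rewrite !leq_mul.
- by rewrite sum_card_subst_at mulnCA leq_mul2l dense orbT.
have [||g [G [injG GP]]] := IHs _ _ _ _ lef.
- exact: leq_trans d0 (@leq_iter_clone_loss _ d 1 t0 d0).
- by move: leA; rewrite /= -iterSr.
exists g, (fun j => if j == i then f else G j); split=> [j|c].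
  by rewrite inE; case: eqP => // _; apply: injG.
have := GP c; rewrite inE => /forallP/(_ (c i)).
congr (_ \in P); apply/ffunP => j; rewrite !ffunE inE.
by case: eqP => [->|].
Qed.
End CloneCoordinates.

(** * From homomorphisms to copies *)

(** A vertex [x] of [H] is sent to its own clone of [w x], which makes the map
    injective.  An edge of [H] uses at most one clone of each vertex of [F],
    as [w] is injective on it; so it lies in a section that contains the chosen
    copy of [F]. *)
Lemma arrows_blowup (I A U W : finType) (F : {set {set U}}) (H : {set {set W}})
    (w : W -> U) n :
  0 < #|W| -> 0 < #|I| ->
  triple_system F -> triple_system H -> (forall e, e \in H -> w @: e \in F) ->
  arrows I F n ->
  2 * iter #|U| (clone_loss #|W|) (#|I| ^ #|U|) * #|W| <= #|A| ->
  arrows (I * A)%type H n.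
Proof.
move=> W0 I0 F3 H3 homw arrF leA E.
have /card_gt0P[x0 _] := W0.
pose sec (g : {ffun I -> A}) i := (i, g i).
pose trace g := [set e : {set I} | sec g @: e \in E].
have [[g [f [injf bluef]]]|noblue] :=
    EM (exists g, contains_copy (complete3 n) (~: trace g)).
  right; exists (sec g \o f); split=> [i j [/injf]|e eK] //.
  by have := bluef e eK; rewrite (imset_comp (sec g) f) !in_setC inE.
left.
have D0 : 0 < #|I| ^ #|U| by rewrite expn_gt0 I0.
have A0 : 0 < #|A|.
  apply: leq_trans leA; rewrite muln_gt0 W0 andbT muln_gt0.
  exact: leq_trans D0 (leq_iter_clone_loss _ W0 D0).
pose C (u : {ffun U -> I}) :=
  [set g | injectiveb u && [forall e in F, u @: e \in trace g]].
have [||u _] := @pigeonhole _ {ffun I -> A} setT C setT.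
- by rewrite cardsT card_ffun expn_gt0 A0.
- apply/subsetP => g _; apply/bigcupP.
  have [[u [inju redu]]|blue] := arrF (trace g); last by case: noblue; exists g.
  exists [ffun x => u x]; rewrite ?inE //.
  have eqe (e : {set U}) : [ffun x => u x] @: e = u @: e.
    by apply: eq_imset => x; rewrite ffunE.
  apply/andP; split; last by apply/forall_inP => e eF; rewrite eqe redu.
  by apply/injectiveP => x y; rewrite !ffunE; apply: inju.
rewrite !cardsT [#|{ffun U -> I}|]card_ffun => dense.
have [|g [G [injG GC]]] := @clone_coordinates I A W (codom u) _ (C u) D0 W0 _ dense.
  by rewrite size_codom.
have uin y : u y \in codom u by apply: codom_f.
have inju : injective u.
  by have := GC (fun=> x0); rewrite inE => /andP[/injectiveP].
exists (fun x => (u (w x), G (u (w x)) x)); split=> [x y [eqxy]|e eH].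
  by rewrite eqxy => /(injG _ (uin _)).
have weF := homw e eH.
have injw : {in e &, injective w} by apply/imset_injP; rewrite (F3 _ weF) (H3 _ eH).
(* [c] selects, over each vertex of the copy of [F], the clone that [e] uses. *)
pose c i := odflt x0 [pick x in e | u (w x) == i].
have cK x : x \in e -> c (u (w x)) = x.
  move=> xe; rewrite /c; case: pickP => [y /andP[ye /eqP/inju/injw-> //]|].
  by move/(_ x); rewrite /= xe eqxx.
have := GC c; rewrite inE => /andP[_ /forall_inP/(_ _ weF)].
rewrite inE -!imset_comp; congr (_ \in E); apply: eq_in_imset => x xe /=.
by rewrite /sec ffunE uin cK.
Qed.

Lemma ramsey_property_arrows (V W : finType) (H : {set {set W}}) n :
  arrows V H n -> ramsey_property H (complete3 n) #|V|.
Proof.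
move=> arrV red _.
have [[f [injf redf]]|[f [injf bluef]]] :=
  arrV [set e : {set V} | enum_rank @: e \in red]; [left | right].
  exists (enum_rank \o f); split=> [|e /redf]; first exact: inj_comp enum_rank_inj injf.
  by rewrite inE (imset_comp enum_rank f).
exists (enum_rank \o f); split=> [|e eK]; first exact: inj_comp enum_rank_inj injf.
have := bluef e eK; rewrite !inE (imset_comp enum_rank f) => ->.
by rewrite !card_imset //; [move: eK; rewrite inE | apply: enum_rank_inj].
Qed.

(** * Closed tight walks *)

Lemma path3_triple_system k : triple_system (path3 k).
Proof.
move=> e; rewrite inE => /existsP[a /existsP[b /existsP[c /and3P[/eqP eb bc /eqP->]]]].
have ab : a < b by rewrite eb.
have ac : a < c := ltn_trans ab bc.
by rewrite setUC cardsU1 cards2 !inE -!val_eqE /= (gtn_eqF ac) (gtn_eqF bc) (ltn_eqF ab).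
Qed.

Section TightWalks.
Variable k : nat.

Definition ordered_path_edge (a b c : nat) : bool := [&& b == a.+1, b < c & c <= k].

Definition path_edge (a b c : nat) : bool :=
  [|| ordered_path_edge a b c, ordered_path_edge b a c, ordered_path_edge a c b,
      ordered_path_edge b c a, ordered_path_edge c a b | ordered_path_edge c b a].

Fixpoint tight_walk (p : seq nat) : bool :=
  if p is a :: p' then
    (if p' is b :: c :: _ then path_edge a b c else true) && tight_walk p'
  else true.

Lemma path_edgeP a b c : path_edge a b c ->
  [set inord a; inord b; inord c] \in path3 k.+1.
Proof.
have edgeP x y z : ordered_path_edge x y z ->
    [set inord x; inord y; inord z] \in path3 k.+1.
  case/and3P => /eqP yx yz zk; rewrite inE.
  apply/existsP; exists (inord x); apply/existsP; exists (inord y).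
  apply/existsP; exists (inord z); rewrite eqxx andbT.
  have yk : y <= k by apply: leq_trans zk; apply: ltnW.
  have xk : x <= k by apply: leq_trans yk; rewrite yx.
  by rewrite !inordK ?ltnS // yz yx eqxx.
have swap (x y z : 'I_k.+1) : [set x; y; z] = [set x; z; y] by rewrite setUAC.
have flip (x y z : 'I_k.+1) : [set x; y; z] = [set y; x; z] by rewrite (setUC [set x]).
case/or4P=> [||| /or3P[||]] /edgeP //.
- by rewrite flip.
- by rewrite swap.
- by rewrite swap flip.
- by rewrite flip swap.
- by rewrite flip swap flip.
Qed.

Lemma tight_walk_nth p i : tight_walk p -> i.+2 < size p ->
  path_edge (nth 0 p i) (nth 0 p i.+1) (nth 0 p i.+2).
Proof.
elim: p i => // a p IHp [|i] /= /andP[walka walkp] ltip; last exact: IHp.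
by case: p walka ltip {IHp walkp} => [|b [|c p]].
Qed.

(** Appending the first two letters of the closed walk [p] turns its cyclic
    windows of length 3 into ordinary ones. *)
Lemma tight_cycle_hom s (p : seq nat) : 3 < s -> size p = s ->
  tight_walk (p ++ take 2 p) ->
  forall e, e \in tight_cycle s ->
    (fun z : 'Z_s => inord (nth 0 p z) : 'I_k.+1) @: e \in path3 k.+1.
Proof.
move=> s3 szp walkp e /imsetP[z _ ->]; rewrite !imsetU !imset_set1.
have s1 : 1 < s by apply: leq_trans s3.
have lezs : z < s by rewrite -[s in _ < s]Zp_cast.
have modE m : m %% (Zp_trunc s).+2 = m %% s by rewrite Zp_cast.
have cyc j : j < 3 -> nth 0 p ((z + j) %% s) = nth 0 (p ++ take 2 p) (z + j).
  move=> j3; rewrite nth_cat szp; case: ltnP => [lt|ge]; first by rewrite modn_small.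
  rewrite -{1}(subnK ge) modnDr modn_small; last by lia.
  by rewrite nth_take //; lia.
have -> : nth 0 p (z + 1)%R = nth 0 (p ++ take 2 p) z.+1.
  by rewrite -(addn1 z) -cyc //= !modE (modn_small s1).
have -> : nth 0 p (z + 2%:R)%R = nth 0 (p ++ take 2 p) z.+2.
  have two : (2%:R : 'Z_s)%R = 2 :> nat by rewrite val_Zp_nat // modn_small // ltnW.
  rewrite -(addn2 z) -cyc //; congr nth.
  by rewrite -[LHS]/((z + (2%:R : 'Z_s)%R) %% (Zp_trunc s).+2) two modE.
have -> : nth 0 p z = nth 0 (p ++ take 2 p) z by rewrite nth_cat szp lezs.
apply/path_edgeP/tight_walk_nth => //.
by rewrite size_cat size_take szp (leq_trans _ s3) // addn2 !ltnS.
Qed.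
End TightWalks.

(** The closed walks 0132412 and 01234213 have lengths 7 and 8; both begin with
    0, 1, so any number of rounds 012 can be put in front of them. *)
Lemma tight_cycle_path3_hom s : 7 <= s -> ~~ (3 %| s) ->
  exists w : 'Z_s -> 'I_5, forall e, e \in tight_cycle s -> w @: e \in path3 5.
Proof.
move=> s7 s3.
(* The initial letters 0, 1 are kept explicit for the walk conditions to compute. *)
pose pad m p := iter m (cat [:: 0; 1; 2]) (0 :: 1 :: p).
have size_pad m p : size (pad m p) = 3 * m + (size p).+2.
  by rewrite /pad; elim: m => //= m ->; rewrite mulnS.
have take_pad m p : take 2 (pad m p) = [:: 0; 1].
  by case: m => //=; rewrite take0.
have walk_pad m p : tight_walk 4 [:: 0, 1 & p ++ [:: 0; 1]] ->
    tight_walk 4 (pad m p ++ take 2 (pad m p)).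
  rewrite take_pad => walkp; elim: m => //= m.
  by case: m => [|m] /= ->.
suff [m [p [szp walkp]]] : exists m p,
    size (pad m p) = s /\ tight_walk 4 [:: 0, 1 & p ++ [:: 0; 1]].
  exists (fun z => inord (nth 0 (pad m p) z)).
  by apply: tight_cycle_hom => //; [apply: leq_trans s7 | apply: walk_pad].
have [s1|s2] : s %% 3 = 1 \/ s %% 3 = 2.
  by move: s3; rewrite /dvdn; have := ltn_pmod s (isT : 0 < 3); case: (s %% 3) => [|[|[|]]]; auto.
- exists ((s - 7) %/ 3), [:: 3; 2; 4; 1; 2]; split=> //.
  by rewrite size_pad /=; lia.
- exists ((s - 8) %/ 3), [:: 2; 3; 4; 2; 1; 3]; split=> //.
  by rewrite size_pad /=; lia.
Qed.

(** * The bound *)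

Lemma iter_clone_loss_poly t k a : exists b, forall X d, 1 < X -> d <= X ^ a ->
  iter k (clone_loss t) d <= X ^ b.
Proof.
elim: k => [|k [b IHk]]; first by exists a.
exists (1 + b + (1 + b + t) * t) => X d X1 led /=.
have leb := IHk X d X1 led; rewrite /clone_loss expnD.
have le2 : 2 * iter k (clone_loss t) d <= X ^ (1 + b) by rewrite expnD leq_mul.
have let_ : t <= X ^ t by apply: ltnW; apply: ltn_expl.
rewrite leq_mul // expnM; have [->|t0] := posnP t; first by rewrite !expn0.
by rewrite leq_exp2r // expnD leq_mul.
Qed.

Lemma tight_cycle_ramsey_bound s : 7 <= s -> ~~ (3 %| s) ->
  exists C, forall n, 2 <= n -> exists2 M,
    ramsey_property (tight_cycle s) (complete3 n) M & M <= n ^ (n * C).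
Proof.
move=> s7 s3; have s1 : 1 < s by apply: leq_trans s7.
have [w homw] := tight_cycle_path3_hom s7 s3.
(* 60 = 5 * 12: the initial inverse density is N ^ 5, where N = (n ^ n) ^ 12 below. *)
have [b leb] := iter_clone_loss_poly s 5 60.
exists (12 + (1 + b + s)) => n n2.
set N := (n ^ 4) ^ (3 * n); set L := 2 * iter 5 (clone_loss s) (N ^ 5) * s.
have NE : N = (n ^ n) ^ 12 by rewrite /N -!expnM; congr (_ ^ _); lia.
have X1 : 1 < n ^ n by apply: leq_ltn_trans (ltn_expl n n2); apply: ltnW.
exists #|{: 'I_N * 'I_L}|.
  apply: ramsey_property_arrows.
  apply: (arrows_blowup _ _ (@path3_triple_system 5) _ homw).
  - by rewrite card_ord.
  - by rewrite card_ord !expn_gt0 ltnW.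
  - by apply: tight_cycle_triple_system; apply: leq_trans s7.
  - by apply: path3_or_clique; rewrite ?card_ord.
  - by rewrite !card_ord Zp_cast.
rewrite card_prod !card_ord expnM expnD leq_mul //; first by rewrite NE.
rewrite expnD expnD !leq_mul //; last by apply: ltnW; apply: ltn_expl.
by apply: leb => //; rewrite NE -expnM.
Qed.

Import Order.TTheory GRing.Theory Num.Theory.

Theorem theorem1p3 (R : realType) (s : nat) :
  ~~ (3 %| s) ->
  (16 <= s) \/ (s \in [:: 8; 11; 14]) ->
  exists c : R, (0 < c)%R /\
    forall n : nat, 2 <= n ->
      exists N : nat,
        is_ramsey_number (tight_cycle s) (complete3 n) N /\
        (N%:R < 2%:R `^ (c * n%:R * ln n%:R))%R.
Proof.
move=> s3 s_cases; have s7 : 7 <= s.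
  by case: s_cases => [/(leq_trans _)->//|]; rewrite !inE => /or3P[]/eqP->.
have [C boundC] := tight_cycle_ramsey_bound s7 s3.
have ln2 : (0 < ln 2%:R :> R)%R by apply: ln_gt0; rewrite ltr1n.
exists (C.+1%:R / ln 2%:R)%R; split=> [|n n2].
  by rewrite divr_gt0 // ltr0n.
have [M ramM leM] := boundC n n2.
have exN : exists N, `[< ramsey_property (tight_cycle s) (complete3 n) N >].
  by exists M; apply/asboolP.
case: (ex_minnP exN) => N /asboolP ramN minN; exists N; split.
  by split=> // M' ramM'; apply: minN; apply/asboolP.
have leN : N <= n ^ (n * C) by apply: leq_trans leM; apply: minN; apply/asboolP.
have n0 : (0 < n%:R :> R)%R by rewrite ltr0n ltnW.
(* The factor 1 / ln 2 in the constant turns the power of 2 into a power of n. *)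
have -> : (2%:R `^ (C.+1%:R / ln 2%:R * n%:R * ln n%:R) = (n ^ (n * C.+1))%:R :> R)%R.
  rewrite /powR pnatr_eq0 /=.
  have -> : (C.+1%:R / ln 2%:R * n%:R * ln n%:R * ln 2%:R =
            (n * C.+1)%:R * ln n%:R :> R)%R.
    by rewrite natrM; field; rewrite gt_eqF.
  by rewrite expRM_natl lnK ?posrE // natrX.
rewrite ltr_nat; apply: leq_ltn_trans leN _.
by rewrite ltn_exp2l // ltn_pmul2l // ltnW.
Qed.
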